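(* Let $A$ be a set with at least three elements and $I$ a finite set of $n$ individuals. Every map $C\colon\mathrm{LPO}_A^I\to\mathrm{LPO}_A$ satisfying unanimity and independence of irrelevant alternatives is the lexicographic voting rule $\mathrm{Lex}_\pi$ of a unique sequence $\pi=(k_1,\dots,k_\ell)$ of $\ell\ge 0$ distinct individuals of $I$. Conversely, for each such sequence, $\mathrm{Lex}_\pi\colon\mathrm{LPO}_A^I\to\mathrm{LPO}_A$ satisfies unanimity and independence of irrelevant alternatives. If $C$ moreover satisfies strong unanimity, then $\ell=n$; thus there are exactly $n!$ maps $\mathrm{LPO}_A^I\to\mathrm{LPO}_A$ satisfying strong unanimity and independence of irrelevant alternatives, each corresponding to a permutation of $I$.
   Context: $\mathrm{LPO}_A$ is the set of complete preorders on $A$ (reflexive, transitive, and for all $a,b$: $(a,b)\in P$ or $(b,a)\in P$). For a profile $P=(P_i)_{i\in I}$: $a\succsim b$ means $(a,b)\in C(P)$, $a\succsim_i b$ means $(a,b)\in P_i$; $\succ$ is the strict part and $\sim$ indifference (both directions). Unanimity: if $a\succsim_i b$ for all $i$ then $a\succsim b$. Strong unanimity: unanimity, and if $a\succsim_i b$ for all $i$ and $a\succ_i b$ for some $i$, then $a\succ b$. IIA: for profiles $P,P'$ with outcomes $\succsim,\succsim'$, if $\{i:a\succsim_i b\}=\{i:a\succsim'_i b\}$ and $\{i:b\succsim_i a\}=\{i:b\succsim'_i a\}$ then $a\succsim b\iff a\succsim' b$. The lexicographic rule $\mathrm{Lex}_\pi$ for $\pi=(k_1,\dots,k_\ell)$: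 given $a,b$, set $a\sim b$ if $a\sim_{k_\lambda} b$ for all $\lambda$; otherwise let $k$ be the first $k_\lambda$ with not $a\sim_k b$, and set $a\succ b$ if $a\succ_k b$, and $b\succ a$ if $b\succ_k a$ (so $k_1$ decides, in case of indifference $k_2$ decides, etc.). *)

(* Defs.v *)
From mathcomp Require Import all_boot.
From mathcomp Require Import boolp classical_sets functions cardinality.
Set Implicit Arguments.
Unset Strict Implicit.
Unset Printing Implicit Defensive.
Local Open Scope classical_set_scope.

Record LPO (A : Type) := MkLPO {
  graph : set (A * A);
  LPO_refl : forall a, graph (a, a);
  LPO_trans : forall a b c, graph (a, b) -> graph (b, c) -> graph (a, c);
  LPO_total : forall a b, graph (a, b) \/ graph (b, a) }.

Section Preferences.
Variables (A : Type) (P : LPO A).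

Definition weakly (a b : A) : Prop := graph P (a, b).
Definition strictly (a b : A) : Prop := weakly a b /\ ~ weakly b a.
Definition indifferent (a b : A) : Prop := weakly a b /\ weakly b a.

End Preferences.

Definition profile (A : Type) (I : finType) := I -> LPO A.
Definition rule (A : Type) (I : finType) := profile A I -> LPO A.

Section Rules.
Variables (A : Type) (I : finType).
Implicit Types (C : rule A I) (P : profile A I).

Definition unanimity C : Prop :=
  forall P a b, (forall i, weakly (P i) a b) -> weakly (C P) a b.

Definition strong_unanimity C : Prop :=
  unanimity C /\
  forall P a b, (forall i, weakly (P i) a b) ->
    (exists i, strictly (P i) a b) -> strictly (C P) a b.

Definition IIA C : Prop :=
  forall P P' a b,
    [set i | weakly (P i) a b] = [set i | weakly (P' i) a b] ->
    [set i | weakly (P i) b a] = [set i | weakly (P' i) b a] ->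
    (weakly (C P) a b <-> weakly (C P') a b).

(* [lex_indifferent] is the case "a ~ b"; [lex_strictly] is the case "a > b",
   where [k] is the first individual of [s] who is not indifferent. *)
Definition lex_indifferent (s : seq I) P (a b : A) : Prop :=
  forall k, k \in s -> indifferent (P k) a b.

Definition lex_strictly (s : seq I) P (a b : A) : Prop :=
  exists s1 k s2, [/\ s = s1 ++ k :: s2,
    (forall j, j \in s1 -> indifferent (P j) a b) & strictly (P k) a b].

Definition lex_graph (s : seq I) P : set (A * A) :=
  [set ab | lex_indifferent s P ab.1 ab.2 \/ lex_strictly s P ab.1 ab.2].

Lemma lex_graph_nil P a b : lex_graph [::] P (a, b).
Proof. by left. Qed.

Lemma lex_graph_cons k s P a b :
  lex_graph (k :: s) P (a, b) <->
  strictly (P k) a b \/ indifferent (P k) a b /\ lex_graph s P (a, b).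
Proof.
split=> [[h|[[|j s1] [l [s2 [/= [-> ->] h1 h2]]]]]|[h|[h1 [h2|[s1 [l [s2 [-> h2 h3]]]]]]]].
- right; split; first by apply: h; rewrite mem_head.
  by left=> j js; apply: h; rewrite inE js orbT.
- by left.
- right; split; first by apply: h1; rewrite mem_head.
  right; exists s1, l, s2; split=> // i is1.
  by apply: h1; rewrite inE is1 orbT.
- by right; exists [::], k, s.
- by left=> j; rewrite inE => /orP[/eqP->//|]; apply: h2.
- right; exists (k :: s1), l, s2; split=> // j.
  by rewrite inE => /orP[/eqP->//|]; apply: h2.
Qed.

Lemma lex_graph_refl s P a : lex_graph s P (a, a).
Proof. by left=> k _; split; apply: LPO_refl. Qed.

Lemma lex_graph_trans s P a b c :
  lex_graph s P (a, b) -> lex_graph s P (b, c) -> lex_graph s P (a, c).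
Proof.
elim: s => [|k s IH]; first by move=> *; apply: lex_graph_nil.
have tr := @LPO_trans _ (P k).
rewrite !lex_graph_cons /strictly /indifferent /weakly.
move=> [[ab nba]|[[ab ba] sab]] [[bc ncb]|[[bc cb] sbc]].
- by left; split; [exact: tr ab bc|move=> ca; apply: nba; exact: tr bc ca].
- by left; split; [exact: tr ab bc|move=> ca; apply: nba; exact: tr bc ca].
- by left; split; [exact: tr ab bc|move=> ca; apply: ncb; exact: tr ca ab].
- by right; split; [split; [exact: tr ab bc|exact: tr cb ba]|exact: IH].
Qed.

Lemma lex_graph_total s P a b :
  lex_graph s P (a, b) \/ lex_graph s P (b, a).
Proof.
elim: s => [|k s IH]; first by left; apply: lex_graph_nil.
rewrite !lex_graph_cons /strictly /indifferent /weakly.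
have [ab|nab] := pselect (graph (P k) (a, b));
have [ba|nba] := pselect (graph (P k) (b, a)).
- by case: IH => h; [left|right]; right.
- by left; left.
- by right; left.
- by case: (LPO_total (P k) a b).
Qed.

Definition Lex (s : seq I) : rule A I := fun P =>
  MkLPO (@lex_graph_refl s P) (@lex_graph_trans s P) (@lex_graph_total s P).

End Rules.

Arguments Lex {A I} s.

(* Main.v *)
(* By unanimity and IIA the outcome on a pair depends only on the sign vector
   recording how each individual compares the two alternatives, and not on the
   pair: unanimous indifference lets one alternative be replaced by another.
   Transitivity through a third alternative makes the set F of vectors with a
   weakly preferred outcome closed under addition, and F contains v or -v for
   each v. If F is not everything, then, restricted to the vectors supported on
   a set S of individuals, it has a dictator k in S; when k is indifferent the
   argument is repeated on S minus k. The sequence of these successive dictators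
   is the lexicographic order; it stops when the remaining individuals have no
   influence. *)
Require Import Defs.
From mathcomp Require Import all_boot.
From mathcomp Require Import boolp classical_sets functions cardinality.
From mathcomp Require Import order ssralg ssrnum ssrint zify.
Import Order.TTheory.
Local Open Scope classical_set_scope.
Local Open Scope card_scope.

Set Implicit Arguments.
Unset Strict Implicit.
Unset Printing Implicit Defensive.

(** * Sign vectors, cones of them, and their lexicographic form *)

Definition same_sign (I : Type) (v w : I -> int) : Prop :=
  forall i, ((0 <= v i)%R = (0 <= w i)%R) /\ ((v i <= 0)%R = (w i <= 0)%R).

(* A vector [v] records the comparison of two alternatives by all individuals:
   [v i > 0], [v i = 0] and [v i < 0] stand for a >_i b, a ~_i b and b >_i a.
   A sign cone is the set of vectors leading to a weakly preferred to b. *)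
Definition sign_cone (I : Type) (F : (I -> int) -> Prop) : Prop :=
  [/\ forall v, (forall i, (0 <= v i)%R) -> F v,
      forall v w, same_sign v w -> F v -> F w,
      forall v w, F v -> F w -> F (fun i => v i + w i)%R
    & forall v, F v \/ F (fun i => - v i)%R].

Fixpoint lex_nonneg (I : Type) (s : seq I) (v : I -> int) : bool :=
  if s is k :: s' then (0 < v k)%R || ((v k == 0%R) && lex_nonneg s' v)
  else true.

(** Once entries are normalised to -1, 0, 1, the difference of the two vectors is nonnegative, hence
    in [F], and closure under addition applies. *)
Lemma sign_cone_mono (I : Type) (F : (I -> int) -> Prop) (v w : I -> int) :
  sign_cone F ->
  (forall i, ((0 <= v i)%R -> (0 <= w i)%R) /\ ((0 < v i)%R -> (0 < w i)%R)) ->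
  F v -> F w.
Proof.
move=> [pos sgn add _] vw Fv.
pose sg (u : I -> int) i : int :=
  if (0 < u i)%R then 1%R else if (u i < 0)%R then (-1)%R else 0%R.
have sgE u : same_sign u (sg u) by move=> i; rewrite /sg; case: ltgtP.
have Fd : F (fun i => sg w i - sg v i)%R.
  by apply: pos => i; have := vw i; rewrite /sg; do 2 case: ltgtP => ?; lia.
apply: sgn (add _ _ (sgn _ _ (sgE v) Fv) Fd) => i.
by have := sgE w i; lia.
Qed.

(* Arrow's argument: a minimal decisive coalition is a single individual, since
   otherwise splitting it in two produces a Condorcet cycle. *)
Lemma sign_cone_dictator (I : finType) (F : (I -> int) -> Prop) (S : {set I})
    (v0 : I -> int) :
  sign_cone F -> (forall i, i \notin S -> v0 i = 0%R) -> ~ F v0 ->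
  exists2 k, k \in S &
    forall v, (forall i, i \notin S -> v i = 0%R) -> (0 < v k)%R ->
      ~ F (fun i => - v i)%R.
Proof.
move=> Fc v0S nFv0; have [pos sgn add _] := Fc.
(* [~ F (u B)] says that [B] prevails when all its members oppose the rest of [S], everyone outside
   [S] being indifferent. *)
pose u (B : {set I}) i : int :=
  if i \in B then (-1)%R else if i \in S then 1%R else 0%R.
pose dec := [pred B : {set I} | `[< ~ F (u B) >]].
have decS : dec S.
  apply/asboolP => Fu; apply: nFv0; apply: sign_cone_mono Fu => // i.
  by rewrite /u; case: ifPn => iS; [lia|rewrite (negPf iS) v0S].
have [B /minsetP[/asboolP decB minB] BS] := minset_exists decS.
have /set0Pn[k kB] : B != finset.set0.
  apply/eqP => B0; apply: decB; apply: pos => i.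
  by rewrite /u B0 inE; case: ifP.
have kS : k \in S by apply: (fintype.subsetP BS).
have nFk : ~ F (u [set k]%SET).
  move=> Fk; have FB : F (u (B :\ k)%SET).
    apply: contrapT => nFB.
    have E := minB (B :\ k)%SET (asboolT nFB) (subD1set _ _).
    by move: kB; rewrite -E !inE eqxx.
  (* The weight -2 keeps the sign but outweighs a 1, so the sum of [t [set k]] and [t (B :\ k)] has
     the signs of [u B]. *)
  pose t (D : {set I}) i : int :=
    if i \in D then (-2)%R else if i \in S then 1%R else 0%R.
  have ut D : same_sign (u D) (t D).
    by move=> i; rewrite /u /t; case: ifP => // _; case: ifP.
  have Fkt := sgn _ _ (ut [set k]%SET) Fk.
  have FBt := sgn _ _ (ut (B :\ k)%SET) FB.
  apply: decB; apply: sgn (add _ _ Fkt FBt) => i.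
  rewrite /u /t !inE; case: eqP => [->|_] /=; first by rewrite kB kS.
  have := fintype.subsetP BS i.
  by case: (i \in B) => [->|_] //; case: ifP.
(* [u [set k]] is the worst case for [k]: everyone else in [S] is opposed. *)
exists k => // v vS vk Fv; apply: nFk; apply: sign_cone_mono Fv => // i.
rewrite /u inE; case: eqP => [->|_]; first by lia.
by case: ifPn => [iS|/vS ->]; lia.
Qed.

Lemma sign_cone_lex (I : finType) (F : (I -> int) -> Prop) :
  sign_cone F -> exists2 s, uniq s & forall v, F v <-> lex_nonneg s v.
Proof.
move=> Fc; have [pos sgn _ tot] := Fc.
suff H n (S : {set I}) : #|S| = n -> exists s, [/\ uniq s, {subset s <= S} &
    forall v, (forall i, i \notin S -> v i = 0%R) -> (F v <-> lex_nonneg s v)].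
  have [s [us _ sF]] := H _ [set: I]%SET erefl.
  by exists s => // v; apply: sF => i; rewrite inE.
elim: n S => [|n IH] S cS.
  exists [::]; split=> // v vS; split=> // _; apply: pos => i.
  by rewrite vS // (cards0_eq cS) inE.
have [[v0 [v0S nFv0]]|all] :=
    pselect (exists v0, (forall i, i \notin S -> v0 i = 0%R) /\ ~ F v0); last first.
  exists [::]; split=> // v vS; split=> // _.
  by apply: contrapT => nFv; apply: all; exists v.
have [k kS kdict] := sign_cone_dictator Fc v0S nFv0.
have [|s [us sS sF]] := IH (S :\ k)%SET.
  by move: cS; rewrite (cardsD1 k) kS => -[].
exists (k :: s); split.
- by rewrite /= us andbT; apply/negP => /sS; rewrite !inE eqxx.
- by move=> i; rewrite inE => /orP[/eqP->//|/sS]; rewrite inE => /andP[].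
(* If [v k] is nonzero, dictatorship for [v] or [-v] decides; if it is zero, [v] is supported on
   [S :\ k] and induction applies. *)
- move=> v vS /=; case: (ltgtP 0%R (v k)) => vk /=.
  + by split=> // _; have [//|/kdict] := tot v; case.
  + split=> // Fv; case: (kdict (fun i => - v i)%R) => [i /vS ->||] //.
      by lia.
    by apply: sgn Fv => i; lia.
  + rewrite -sF //.
    move=> i; rewrite !inE negb_and negbK => /orP[/eqP ->|/vS//].
    by rewrite -vk.
Qed.

(** Test vectors recover the sequence: the constant -1 detects emptiness, 1 at [k] and -1 elsewhere
    detects the head, and vectors vanishing at [k] compare the tails, where [k] does not occur. *)
Lemma lex_nonneg_inj (I : eqType) (s t : seq I) :
  uniq s -> uniq t -> lex_nonneg s =1 lex_nonneg t -> s = t.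
Proof.
elim: s t => [|k s IH] [|j t] //=.
- by move=> _ _ /(_ (fun=> -1)%R).
- by move=> _ _ /(_ (fun=> -1)%R).
move=> /andP[ks us] /andP[jt ut] E.
have kj : k = j.
  apply/eqP/negPn/negP => kj; have := E (fun i => if i == k then 1 else -1)%R.
  by rewrite eqxx (eq_sym j) (negPf kj).
subst j; congr (_ :: _); apply: IH => // v.
have drop r : k \notin r -> lex_nonneg r (fun i => if i == k then 0 else v i)%R =
    lex_nonneg r v.
  elim: r => //= i r IHr; rewrite inE negb_or eq_sym => /andP[/negPf -> kr].
  by rewrite IHr.
have := E (fun i => if i == k then 0 else v i)%R.
by rewrite eqxx /= !drop.
Qed.

Lemma lex_nonneg_ge0 (I : Type) (s : seq I) (v : I -> int) :
  (forall i, (0 <= v i)%R) -> lex_nonneg s v.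
Proof.
by move=> v0; elim: s => //= k s ->; have := v0 k; lia.
Qed.

Lemma lex_nonneg_lt0 (I : eqType) (s : seq I) (v : I -> int) (k : I) :
  (forall i, (v i <= 0)%R) -> k \in s -> (v k < 0)%R -> ~~ lex_nonneg s v.
Proof.
move=> v0 + vk; elim: s => //= j s IH; rewrite inE => /orP[/eqP <-|/IH/negPf->].
  by rewrite negb_or negb_and; lia.
by have := v0 j; lia.
Qed.

Lemma lex_nonneg_eq0 (I : eqType) (s : seq I) (v : I -> int) :
  (forall i, i \in s -> v i = 0%R) -> lex_nonneg s v.
Proof.
elim: s => //= k s IH vs; rewrite vs ?mem_head //= IH //.
by move=> i si; apply: vs; rewrite inE si orbT.
Qed.

(** * Preorders from integer ranks, and the vectors of a profile *)

Lemma LPO_ext (A : Type) (P Q : LPO A) :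
  (forall a b, weakly P a b <-> weakly Q a b) -> P = Q.
Proof.
case: P Q => [g r1 t1 o1] [h r2 t2 o2] /= gh.
have E : g = h by apply/funext => -[a b]; apply/propext/gh.
by subst h; congr MkLPO; apply: Prop_irrelevance.
Qed.

Section RankOrder.
Variables (A : Type) (r : A -> int).
Let rank_graph : set (A * A) := [set ab | (r ab.2 <= r ab.1)%R].
Let rank_refl a : rank_graph (a, a). Proof. exact: Order.POrderTheory.lexx. Qed.
Let rank_trans a b c :
  rank_graph (a, b) -> rank_graph (b, c) -> rank_graph (a, c).
Proof. by rewrite /rank_graph /=; lia. Qed.
Let rank_total a b : rank_graph (a, b) \/ rank_graph (b, a).
Proof. by rewrite /rank_graph /=; lia. Qed.

Definition rank_LPO : LPO A := MkLPO rank_refl rank_trans rank_total.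

Lemma rank_LPOE a b : weakly rank_LPO a b <-> (r b <= r a)%R.
Proof. by []. Qed.
End RankOrder.

(** Only the signs of [v] matter; integers allow [v] to be a difference of ranks and make addition
    of vectors meaningful. *)
Definition compares (A : Type) (I : finType) (P : profile A I) (a b : A)
    (v : I -> int) : Prop :=
  forall i, (weakly (P i) a b <-> (0 <= v i)%R) /\
            (weakly (P i) b a <-> (v i <= 0)%R).

Lemma compares_exists (A : Type) (I : finType) (P : profile A I) (a b : A) :
  exists v, compares P a b v.
Proof.
exists (fun i => if `[< weakly (P i) a b >] then
    if `[< weakly (P i) b a >] then 0 else 1 else -1)%R => i.
have := LPO_total (P i) a b.
case: asboolP => [ab|nab]; first by case: asboolP.
by case=> // ba; split; split.
Qed.

Lemma compares_sym (A : Type) (I : finType) (P : profile A I) (a b : A) v :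
  compares P a b v -> compares P b a (fun i => - v i)%R.
Proof. by move=> vP i; have [-> ->] := vP i; lia. Qed.

Lemma compares_rank (A : Type) (I : finType) (r : I -> A -> int) (a b : A) v :
  same_sign (fun i => r i a - r i b)%R v ->
  compares (fun i => rank_LPO (r i)) a b v.
Proof. by move=> rv i; rewrite !rank_LPOE; have := rv i; lia. Qed.

Lemma compares_set_eq (A : Type) (I : finType) (P P' : profile A I) (a b : A) v :
  [set i | weakly (P i) a b] = [set i | weakly (P' i) a b] ->
  [set i | weakly (P i) b a] = [set i | weakly (P' i) b a] ->
  compares P a b v -> compares P' a b v.
Proof.
move=> /seteqP[e1 e2] /seteqP[e3 e4] vP i.
have [<- <-] := vP i; split; split.
- exact: e2.
- exact: e1.
- exact: e4.
- exact: e3.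
Qed.

Lemma IIA_compares (A : Type) (I : finType) (C : rule A I) P P' a b v :
  IIA C -> compares P a b v -> compares P' a b v ->
  weakly (C P) a b -> weakly (C P') a b.
Proof.
move=> iC vP vP'; suff -> : weakly (C P) a b <-> weakly (C P') a b by [].
by apply: iC; apply/seteqP; split => i /=; move: (vP i) (vP' i); tauto.
Qed.

Lemma weakly_Lex (A : Type) (I : finType) (s : seq I) (P : profile A I) a b v :
  compares P a b v -> (weakly (Lex s P) a b <-> lex_nonneg s v).
Proof.
move=> vP; rewrite /weakly /=.
elim: s => [|k s IH]; first by split=> // _; exact: lex_graph_nil.
rewrite lex_graph_cons IH /= /strictly /indifferent.
by have [-> ->] := vP k; lia.
Qed.

(** * Neutrality, and the cone of a rule *)

Section Neutrality.
Variables (A : Type) (I : finType) (C : rule A I).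
Hypotheses (uC : unanimity C) (iC : IIA C).
Hypothesis hA : exists a b c : A, [/\ a <> b, a <> c & b <> c].

(** By IIA, one such profile speaks for all profiles with vector [v] on the pair. *)
Let outcome (v : I -> int) (p q : A) : Prop :=
  exists2 P, compares P p q v & weakly (C P) p q.

(* Unanimous indifference between [q] and [r] is enough to replace [q] by [r]. *)
Let outcome_right v (p q r : A) :
  p <> q -> p <> r -> outcome v p q -> outcome v p r.
Proof.
move=> pq pr [P vP CP].
(* All alternatives other than [p] are tied at 0, so [p] compares to each of them by [v]. *)
pose Q i := rank_LPO (fun x => if `[< x = p >] then v i else 0%R).
have Qv x : p <> x -> compares Q p x v.
  move=> px; apply: compares_rank => i /=; rewrite [`[< p = p >]]asboolT //.
  by rewrite ifF; [lia|apply/asboolP => /esym].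
exists Q; first exact: Qv.
apply: (LPO_trans (b := q)); first exact: IIA_compares iC vP (Qv _ pq) CP.
apply: uC => i; apply/rank_LPOE.
by rewrite !ifF //; apply/asboolP => /esym.
Qed.

Let outcome_left v (p q r : A) :
  p <> q -> r <> q -> outcome v p q -> outcome v r q.
Proof.
move=> pq rq [P vP CP].
pose Q i := rank_LPO (fun x => if `[< x = q >] then 0%R else v i).
have Qv x : x <> q -> compares Q x q v.
  move=> xq; apply: compares_rank => i /=; rewrite [`[< q = q >]]asboolT //.
  by rewrite ifF; [lia|exact/asboolP].
exists Q; first exact: Qv.
apply: (LPO_trans (b := p)); last exact: IIA_compares iC vP (Qv _ pq) CP.
apply: uC => i; apply/rank_LPOE.
by rewrite !ifF //; apply/asboolP.
Qed.

Let third (p q : A) : exists r, p <> r /\ q <> r.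
Proof.
have [a [b [c [ab ac bc]]]] := hA.
have [pa|pa] := pselect (p = a); have [qa|qa] := pselect (q = a).
- by exists b; subst.
- by have [qb|qb] := pselect (q = b); [exists c|exists b]; subst.
- by have [qb|qb] := pselect (p = b); [exists c|exists b]; subst.
- by exists a.
Qed.

(** The endpoints are replaced one at a time, in an order that keeps them distinct. Only the swap of
    [p] and [q] admits no such order; it passes through a third alternative. *)
Let outcome_neutral v (p q p' q' : A) :
  p <> q -> p' <> q' -> outcome v p q -> outcome v p' q'.
Proof.
move=> pq pq'; have [e|pq''] := pselect (p = q'); last first.
  by move=> /(outcome_right pq pq'')/(outcome_left pq'' pq').
have [e'|pq''] := pselect (p' = q); last first.
  by move=> /(outcome_left pq pq'')/(outcome_right pq'' pq').
subst p' q'; have [r [pr qr]] := third p q.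
by move=> /(outcome_right pq pr)/(outcome_left pr qr)/(outcome_right qr pq').
Qed.

Let weakly_neutral P P' v (p q p' q' : A) : p <> q ->
  compares P p q v -> compares P' p' q' v ->
  weakly (C P) p q -> weakly (C P') p' q'.
Proof.
move=> pq vP vP' CP; have [e|pq'] := pselect (p' = q').
  by subst q'; exact: LPO_refl.
have [|Q vQ CQ] := @outcome_neutral v p q p' q' pq pq'; first by exists P.
exact: IIA_compares iC vQ vP' CQ.
Qed.

Lemma rule_sign_cone : exists2 F : (I -> int) -> Prop, sign_cone F &
  forall P a b v, compares P a b v -> (weakly (C P) a b <-> F v).
Proof.
have [a [b [c [ab ac bc]]]] := hA.
pose r3 (x y z : I -> int) i (t : A) : int :=
  if `[< t = a >] then x i else if `[< t = b >] then y i else z i.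
have r3a x y z i : r3 x y z i a = x i by rewrite /r3; case: asboolP.
have r3b x y z i : r3 x y z i b = y i.
  by rewrite /r3; case: asboolP => [/esym//|_]; case: asboolP.
have r3c x y z i : r3 x y z i c = z i.
  by rewrite /r3; case: asboolP => [/esym//|_]; case: asboolP => [/esym|].
pose R3 x y z : profile A I := fun i => rank_LPO (r3 x y z i).
(* By neutrality, a single instance with [p <> q] suffices for [F v]. *)
pose F v := forall P p q, compares P p q v -> weakly (C P) p q.
exists F; first split.
- by move=> v v0 P p q vP; apply: uC => i; apply/(vP i).1.
- move=> v w vw Fv P p q wP; apply: Fv => i.
  by have [-> ->] := vw i; exact: wP.
- move=> v w Fv Fw P p q vwP.
  (* The ranks [v + w], [w], 0 of [a], [b], [c] have successive differences [v] and [w], so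
     transitivity through [b] gives the sum. *)
  pose Q := R3 (fun i => v i + w i)%R w (fun=> 0%R).
  apply: (@weakly_neutral Q) vwP _ => //; first exact: ac.
    by apply: compares_rank => i; rewrite r3a r3c; lia.
  apply: (LPO_trans (b := b)).
    by apply: Fv; apply: compares_rank => i; rewrite r3a r3b; lia.
  by apply: Fw; apply: compares_rank => i; rewrite r3b r3c; lia.
- move=> v; pose Q := R3 v (fun=> 0%R) (fun=> 0%R).
  have Qv : compares Q a b v by apply: compares_rank => i; rewrite r3a r3b; lia.
  have [h|h] := LPO_total (C Q) a b; [left|right] => P p q vP.
    exact: weakly_neutral ab Qv vP h.
  exact: weakly_neutral (nesym ab) (compares_sym Qv) vP h.
- move=> P p q v vP; split; last by apply.
  (* Neutrality starts from distinct alternatives; for [p = q], reflexivity forces [v] to be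
     nonnegative and unanimity suffices. *)
  have [e _ P' p' q' vP'|pq CP P' p' q' vP'] := pselect (p = q).
    apply: uC => i; apply/(vP' i).1/(vP i).1.
    by rewrite e; exact: LPO_refl.
  exact: weakly_neutral pq vP vP' CP.
Qed.

Lemma rule_eq_Lex : exists2 s, uniq s & C = Lex s.
Proof.
have [F Fc CF] := rule_sign_cone.
have [s us sF] := sign_cone_lex Fc.
exists s => //; apply/funext => P; apply: LPO_ext => a b.
have [v vP] := compares_exists P a b.
by rewrite (CF _ _ _ _ vP) (weakly_Lex _ vP).
Qed.

End Neutrality.

(** * Lexicographic rules: uniqueness of the sequence and the axioms *)

Lemma two_point_profile (A : Type) (I : finType) (a b : A) (v : I -> int) :
  a <> b -> exists P : profile A I, compares P a b v.
Proof.
move=> ab; exists (fun i => rank_LPO (fun x => if `[< x = a >] then v i else 0%R)).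
apply: compares_rank => i /=; rewrite [`[< a = a >]]asboolT //.
by rewrite ifF; [lia|apply/asboolP => /esym].
Qed.

Lemma Lex_inj (A : Type) (I : finType) (a b : A) (s t : seq I) :
  a <> b -> uniq s -> uniq t -> Lex s = Lex t :> rule A I -> s = t.
Proof.
move=> ab us ut E; apply: lex_nonneg_inj => // v.
have [P vP] := two_point_profile v ab.
by apply/idP/idP => /(weakly_Lex _ vP); rewrite (E, esym E) => /(weakly_Lex _ vP).
Qed.

Lemma Lex_unanimity (A : Type) (I : finType) (s : seq I) :
  unanimity (Lex s : rule A I).
Proof.
move=> P a b Pab; have [v vP] := compares_exists P a b.
by apply/(weakly_Lex _ vP); apply: lex_nonneg_ge0 => i; apply/(vP i).1.
Qed.

Lemma Lex_IIA (A : Type) (I : finType) (s : seq I) : IIA (Lex s : rule A I).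
Proof.
move=> P P' a b e1 e2; have [v vP] := compares_exists P a b.
by rewrite (weakly_Lex _ vP) (weakly_Lex _ (compares_set_eq e1 e2 vP)).
Qed.

Lemma Lex_strong_unanimity (A : Type) (I : finType) (s : seq I) :
  (forall i, i \in s) -> strong_unanimity (Lex s : rule A I).
Proof.
move=> sI; split; first exact: Lex_unanimity.
move=> P a b Pab [k [_ nPba]]; split; first exact: Lex_unanimity.
have [v vP] := compares_exists P a b.
move=> /(weakly_Lex _ (compares_sym vP)); apply/negP.
apply: (@lex_nonneg_lt0 _ _ _ k) => // [i|]; first by have/(vP i).1 := Pab i; lia.
by move: nPba; rewrite (vP k).2; lia.
Qed.

(** An individual outside [s] who alone has a strict preference cannot break the tie among the
    members of [s]. *)
Lemma strong_unanimity_mem (A : Type) (I : finType) (a b : A) (s : seq I) :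
  a <> b -> strong_unanimity (Lex s : rule A I) -> forall i, i \in s.
Proof.
move=> ab [_ sC] k; apply/negPn/negP => ks.
have [P vP] := two_point_profile (fun i => if i == k then 1 else 0)%R ab.
have [|| _ []] := sC P a b.
- by move=> i; apply/(vP i).1; case: ifP.
- by exists k; split; rewrite ((vP k).1, (vP k).2) eqxx.
apply/(weakly_Lex _ (compares_sym vP)); apply: lex_nonneg_eq0 => i si.
by case: eqP => // e; rewrite -e si in ks.
Qed.

(** * Counting the orderings of [I] *)

Lemma uniq_size_card (I : finType) (s : seq I) :
  uniq s -> (size s = #|I| <-> forall i, i \in s).
Proof.
move=> us; rewrite -(card_uniqP us); split=> [e i|sI].
  by rewrite (subset_cardP e _ i) //; apply/fintype.subsetP.
by apply: eq_card.
Qed.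

Lemma card_eq_seq (T : eqType) (s : seq T) :
  uniq s -> [set` s] #= `I_(size s).
Proof.
move=> us; apply/card_set_bijP; exists (index^~ s); split.
- by move=> x /= xs; rewrite index_mem.
- by move=> x y; rewrite !inE => /= xs ys; exact: index_inj.
- move=> n /= ns; case: s us ns => // x0 s us ns.
  by exists (nth x0 (x0 :: s) n); [exact: mem_nth|exact: index_uniq].
Qed.

Lemma card_orderings (I : finType) :
  [set s : seq I | uniq s /\ size s = #|I|] #= `I_(#|I| `!).
Proof.
(* A repetition-free sequence of full length is a permutation of [enum I], and these are already
   enumerated without repetition. *)
have -> : [set s : seq I | uniq s /\ size s = #|I|] =
    [set` permutations (enum I)].
  apply/seteqP; split => s /=; rewrite mem_permutations.
    move=> [us /(uniq_size_card us) sI].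
    by apply: uniq_perm; rewrite ?enum_uniq // => i; rewrite sI mem_enum.
  move=> p; have us : uniq s by rewrite (perm_uniq p) enum_uniq.
  by split=> //; rewrite (perm_size p) cardE.
rewrite cardE -size_permutations ?enum_uniq //.
exact/card_eq_seq/permutations_uniq.
Qed.

Unset Implicit Arguments.

Theorem theorem1p7 (A : Type) (I : finType)
    (hA : exists a b c : A, [/\ a <> b, a <> c & b <> c]) :
  [/\ (forall C : rule A I, unanimity C -> IIA C ->
         exists! s : seq I, uniq s /\ C = Lex s),
      (forall s : seq I, uniq s ->
         unanimity (Lex s : rule A I) /\ IIA (Lex s : rule A I)),
      (forall (C : rule A I) (s : seq I), strong_unanimity C -> IIA C ->
         uniq s -> C = Lex s -> size s = #|I|),
      set_bij [set s : seq I | uniq s /\ size s = #|I|]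
              [set C : rule A I | strong_unanimity C /\ IIA C]
              Lex
    & [set C : rule A I | strong_unanimity C /\ IIA C] #= `I_(#|I| `!)].
Proof.
have [a [b [_ [ab _ _]]]] := hA.
have size_strong s : uniq s -> strong_unanimity (Lex s : rule A I) ->
    size s = #|I|.
  by move=> us /(strong_unanimity_mem ab) sI; apply/uniq_size_card.
have bij : set_bij [set s : seq I | uniq s /\ size s = #|I|]
    [set C : rule A I | strong_unanimity C /\ IIA C] Lex.
  split.
  - move=> s /= [us /(uniq_size_card us) sI].
    by split; [exact: Lex_strong_unanimity|exact: Lex_IIA].
  - by move=> s t; rewrite !inE => /= -[us _] [ut _]; exact: Lex_inj ab us ut.
  - move=> C /= [sC iC]; have [s us Cs] := rule_eq_Lex sC.1 iC hA.
    by exists s => //=; split=> //; apply: size_strong; rewrite -?Cs.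
split=> //.
- move=> C uC iC; have [s us Cs] := rule_eq_Lex uC iC hA.
  exists s; split=> // t [ut Ct].
  by apply: Lex_inj ab us ut _; rewrite -Cs.
- by move=> s us; split; [exact: Lex_unanimity|exact: Lex_IIA].
- by move=> C s sC _ us e; apply: size_strong; rewrite -?e.
- apply: card_eq_trans (card_orderings I); rewrite card_eq_sym.
  by apply/card_eqP; case/Pbij: bij => f _; squash (sigLR f).
Qed.
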